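(* Let $\mathcal{D}$ be a dialgebra over a field $K$ of characteristic zero and let $d$ be a derivation of $\mathcal{D}$. Then: (a) $d(\mathcal{D}^{ann})\subseteq\mathcal{D}^{ann}$; (b) $d(Z_B(\mathcal{D}))\subseteq Z_B(\mathcal{D})$; (c) if $\mathcal{D}$ is unital, then $d(\mathcal{H}(\mathcal{D}))\subseteq\mathcal{D}^{ann}$.
   Context: A dialgebra over $K$ is a $K$-vector space $\mathcal{D}$ with two bilinear associative products $\vdash,\dashv:\mathcal{D}\times\mathcal{D}\to\mathcal{D}$ satisfying, for all $x,y,z\in\mathcal{D}$: $x\dashv(y\dashv z)=x\dashv(y\vdash z)$, $(x\dashv y)\vdash z=(x\vdash y)\vdash z$, and $x\vdash(y\dashv z)=(x\vdash y)\dashv z$. A derivation of $\mathcal{D}$ is a $K$-linear map $d:\mathcal{D}\to\mathcal{D}$ such that $d(a*b)=d(a)*b+a*d(b)$ for all $a,b\in\mathcal{D}$ and for each $*\in\{\vdash,\dashv\}$. $\mathcal{D}^{ann}$ is the linear span of all elements $a\dashv b-a\vdash b$ with $a,b\in\mathcal{D}$. $Z_B(\mathcal{D})=\{z\in\mathcal{D} : z\vdash x=0=x\dashv z\text{ for all }x\in\mathcal{D}\}$. A bar unit is an element $e\in\mathcal{D}$ with $e\vdash x=x\dashv e=x$ for all $x\in\mathcal{D}$; the halo $\mathcal{H}(\mathcal{D})$ is the set of all bar units; $\mathcal{D}$ is unital if it has a (fixed) bar unit. *)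

(* Defs.v *)
From HB Require Import structures.
From mathcomp Require Import all_boot all_algebra.
From mathcomp Require Import classical_sets.

Set Implicit Arguments.
Unset Strict Implicit.
Unset Printing Implicit Defensive.

Import GRing.Theory.
Local Open Scope classical_set_scope.
Local Open Scope ring_scope.

(* [ldprod] is the left product, written x ⊣ y; [rdprod] is the right
   product, written x ⊢ y. *)
HB.mixin Record Lmodule_isDialgebra (K : fieldType) D of GRing.Lmodule K D := {
  ldprod : D -> D -> D;
  rdprod : D -> D -> D;
  ldprod_linearl : forall y, linear (fun x => ldprod x y);
  ldprod_linearr : forall x, linear (ldprod x);
  rdprod_linearl : forall y, linear (fun x => rdprod x y);
  rdprod_linearr : forall x, linear (rdprod x);
  ldprodA : associative ldprod;
  rdprodA : associative rdprod;
  ldprod_bar : forall x y z, ldprod x (ldprod y z) = ldprod x (rdprod y z);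
  rdprod_bar : forall x y z, rdprod (ldprod x y) z = rdprod (rdprod x y) z;
  rldprodA : forall x y z, rdprod x (ldprod y z) = ldprod (rdprod x y) z
}.

#[short(type="dialgType")]
HB.structure Definition Dialgebra (K : fieldType) :=
  {D of Lmodule_isDialgebra K D & GRing.Lmodule K D}.

Notation "x ⊣ y" := (ldprod x y) (at level 40, left associativity) : ring_scope.
Notation "x ⊢ y" := (rdprod x y) (at level 40, left associativity) : ring_scope.

Definition linear_span (K : fieldType) (V : lmodType K) (S : set V) : set V :=
  [set x | exists (n : nat) (c : 'I_n -> K) (s : 'I_n -> V),
    (forall i, S (s i)) /\ x = \sum_(i < n) c i *: s i].

Section DialgebraNotions.
Variables (K : fieldType) (D : dialgType K).

Definition is_derivation (d : {linear D -> D}) : Prop :=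
  (forall a b : D, d (a ⊢ b) = d a ⊢ b + a ⊢ d b) /\
  (forall a b : D, d (a ⊣ b) = d a ⊣ b + a ⊣ d b).

Definition annihilator : set D :=
  linear_span [set x | exists a b : D, x = a ⊣ b - a ⊢ b].

Definition bar_center : set D :=
  [set z | forall x : D, z ⊢ x = 0 /\ x ⊣ z = 0].

Definition is_bar_unit (e : D) : Prop :=
  forall x : D, e ⊢ x = x /\ x ⊣ e = x.

Definition halo : set D := [set e | is_bar_unit e].

Definition unital : Prop := exists e : D, is_bar_unit e.

End DialgebraNotions.

Arguments annihilator {K} D.
Arguments bar_center {K} D.
Arguments halo {K} D.
Arguments unital {K} D.

(* Main.v *)
Require Import Defs.
From HB Require Import structures.
From mathcomp Require Import all_boot all_algebra.
From mathcomp Require Import classical_sets.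

Set Implicit Arguments.
Unset Strict Implicit.
Unset Printing Implicit Defensive.

Import GRing.Theory.
Local Open Scope classical_set_scope.
Local Open Scope ring_scope.

(** All three inclusions come from the Leibniz rule. The annihilator is spanned
by the elements [a ⊣ b - a ⊢ b], and the derivation sends such a generator to
the sum of the generators attached to [(d a, b)] and [(a, d b)]. For [z] in the
bar center, [d z ⊢ x = d (z ⊢ x) - z ⊢ d x = 0], and symmetrically on the other
side. For a bar unit [e], applying [d] to [e ⊢ e = e] gives
[d e = d e ⊢ e + d e], so [d e ⊢ e = 0]; hence [d e = d e ⊣ e - d e ⊢ e] is
itself a generator of the annihilator. *)

Section LinearSpan.
Variables (K : fieldType) (V : lmodType K) (S : set V).

Lemma linear_span_gen x : S x -> linear_span S x.
Proof.
move=> Sx; exists 1%N, (fun=> 1), (fun=> x); split=> //.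
by rewrite big_ord1 scale1r.
Qed.

Lemma linear_span0 : linear_span S 0.
Proof.
by exists 0%N, (fun=> 0), (fun=> 0); split=> [[]//|]; rewrite big_ord0.
Qed.

Lemma linear_spanZ a x : linear_span S x -> linear_span S (a *: x).
Proof.
move=> [n [c [s [Ss ->]]]]; exists n, (fun i => a * c i), s; split=> //.
by rewrite scaler_sumr; apply: eq_bigr => i _; rewrite scalerA.
Qed.

Lemma linear_spanD x y :
  linear_span S x -> linear_span S y -> linear_span S (x + y).
Proof.
move=> [m [c [s [Ss ->]]]] [n [c' [s' [Ss' ->]]]].
exists (m + n)%N.
exists (fun i => match split i with inl j => c j | inr k => c' k end).
exists (fun i => match split i with inl j => s j | inr k => s' k end).
split=> [i|]; first by case: (split i).
rewrite big_split_ord /=; congr (_ + _); apply: eq_bigr => i _.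
  by rewrite (unsplitK (inl i)).
by rewrite (unsplitK (inr i)).
Qed.

Lemma linear_span_sum n (c : 'I_n -> K) (s : 'I_n -> V) :
  (forall i, linear_span S (s i)) -> linear_span S (\sum_(i < n) c i *: s i).
Proof.
move=> Ss; apply: big_ind => [||i _]; first exact: linear_span0.
  exact: linear_spanD.
exact: linear_spanZ.
Qed.

End LinearSpan.

Lemma image_linear_span (K : fieldType) (V W : lmodType K)
    (f : {linear V -> W}) (S : set V) (T : set W) :
  (forall x, S x -> linear_span T (f x)) ->
  f @` linear_span S `<=` linear_span T.
Proof.
move=> fS _ [_ [n [c [s [Ss ->]]]] <-].
rewrite linear_sum; under eq_bigr do rewrite linearZ /=.
by apply: linear_span_sum => i; apply: fS.
Qed.

Section Derivation.
Variables (K : fieldType) (D : dialgType K).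

Lemma annihilator_gen (a b : D) : annihilator D (a ⊣ b - a ⊢ b).
Proof. by apply: linear_span_gen; exists a, b. Qed.

Variable d : {linear D -> D}.
Hypothesis hd : is_derivation d.

Lemma derivation_annihilator : d @` annihilator D `<=` annihilator D.
Proof.
have [dr dl] := hd.
apply: image_linear_span => _ [a [b ->]].
rewrite linearB dl dr opprD addrACA.
by apply: linear_spanD; apply: annihilator_gen.
Qed.

Lemma derivation_bar_center : d @` bar_center D `<=` bar_center D.
Proof.
have [dr dl] := hd.
move=> _ [z Zz <-] x; have [zx xz] := Zz x; have [zdx dxz] := Zz (d x).
split.
  by have := dr z x; rewrite zx zdx linear0 addr0.
by have := dl x z; rewrite xz dxz linear0 add0r.
Qed.

Lemma derivation_halo : d @` halo D `<=` annihilator D.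
Proof.
have [dr _] := hd.
move=> _ [e he <-].
have de_e : d e ⊢ e = 0.
  have := dr e e; rewrite (he e).1 (he (d e)).1 => /esym/eqP.
  by rewrite -subr_eq0 addrK => /eqP.
by have := annihilator_gen (d e) e; rewrite de_e subr0 (he (d e)).2.
Qed.

End Derivation.

Theorem lemma2p7 (K : fieldType) (charK0 : [pchar K] =i pred0)
    (D : dialgType K) (d : {linear D -> D}) (hd : is_derivation d) :
  d @` annihilator D `<=` annihilator D /\
  d @` bar_center D `<=` bar_center D /\
  (unital D -> d @` halo D `<=` annihilator D).
Proof.
split; first exact: derivation_annihilator.
split; first exact: derivation_bar_center.
by move=> _; apply: derivation_halo.
Qed.
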